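(* Let $n\ge 1$, let $p_1\ge p_2\ge\dots\ge p_n\ge 0$ be item prices with $p_1>0$, let $v_0>0$ and $v_1,\dots,v_n\in[0,1]$ be multinomial logit parameters, let $1\le C\le n$ be an integer, and let $\mathcal S=\{S\subseteq\{1,\dots,n\}: |S|\le C\}$. For every tolerance $0<\epsilon<p_1$, the algorithm Assort-MNL (described in the context), run on the capacity-constrained collection $\mathcal S$, returns an $\epsilon$-optimal assortment, i.e. a set $S^*\in\mathcal S$ with $$f(S^* )\ \ge\ \max_{S\in\mathcal S} f(S)-\epsilon,\qquad f(S)=\frac{\sum_{i\in S}p_iv_i}{v_0+\sum_{i\in S}v_i},$$ and it can be implemented so as to run in time $O\!\left(n\,\log C\,\log\frac{p_1}{\epsilon}\right)$.
   Context: Time is counted as the number of elementary arithmetic operations and comparisons of real numbers. Inside $O(\cdot)$, each logarithmic factor is read as at least $1$ (i.e. $\log x$ stands for $\max\{1,\log_2 x\}$); the implied constant is absolute. $f(S)$ is the expected revenue of the assortment $S$ under the multinomial logit choice model, with $f(\emptyset)=0$. Algorithm Assort-MNL (binary search on the optimal revenue). Initialize $L_1=0$, $U_1=p_1$, $S^*=\{1\}$, $j=1$. While $U_j-L_j>\epsilon$: set $K_j=(L_j+U_j)/2$ and test whether $K_j\le\max_{S\in\mathcal S}f(S)$. The test is carried out through the equivalent comparison $$K_j\le \max_{S\in\mathcal S}\frac1{v_0}\sum_{i\in S}v_i(p_i-K_j),$$ where in the capacity-constrained case a maximizing $S$ is obtained by choosing at most $C$ items having the largest values of $v_i(p_i-K_j)$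 among those for which this value is positive. If the test succeeds, set $L_{j+1}=K_j$, $U_{j+1}=U_j$, and let $S^*$ be a set in $\mathcal S$ with $f(S^* )\ge K_j$ (for instance the maximizing set found in the test); otherwise set $L_{j+1}=L_j$, $U_{j+1}=K_j$. Then increase $j$ by one. When the loop ends, return $S^*$. *)

(* Defs.v *)
From HB Require Import structures.
From mathcomp Require Import all_boot all_order all_algebra.
From mathcomp Require Import reals exp.

Set Implicit Arguments.
Unset Strict Implicit.
Unset Printing Implicit Defensive.

Import Order.TTheory GRing.Theory Num.Theory.
Local Open Scope ring_scope.

(* Items 1, ..., n are the ordinals 0, ..., n.-1 of 'I_n. *)

Definition revenue (R : realType) (n : nat) (p v : 'I_n -> R) (v0 : R)
    (S : {set 'I_n}) : R :=
  (\sum_(i in S) p i * v i) / (v0 + \sum_(i in S) v i).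

Definition feasible (n C : nat) (S : {set 'I_n}) : bool := (#|S| <= C)%N.

(* set0 is feasible, so seeding the maximum with its revenue adds nothing. *)
Definition max_revenue (R : realType) (n : nat) (p v : 'I_n -> R) (v0 : R)
    (C : nat) : R :=
  \big[Num.max/revenue p v v0 set0]_(S : {set 'I_n} | feasible C S)
    revenue p v v0 S.

Definition gain (R : realType) (n : nat) (p v : 'I_n -> R) (K : R) (i : 'I_n)
    : R :=
  v i * (p i - K).

(* T consists of min(C, m) items with the largest gains, where m is the number
   of items of positive gain, all of them of positive gain; ties are broken
   arbitrarily. *)
Definition top_choice (R : realType) (n : nat) (p v : 'I_n -> R) (C : nat)
    (K : R) (T : {set 'I_n}) : Prop :=
  let pos := [set i | 0 < gain p v K i] in
  [/\ T \subset pos,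
      #|T| = minn C #|pos|
    & forall i j, i \in T -> j \in pos -> j \notin T ->
        gain p v K j <= gain p v K i].

Record bs_state (R : realType) (n : nat) := BsState {
  lower : R;
  upper : R;
  best : {set 'I_n}
}.

Definition midpoint (R : realType) (n : nat) (s : bs_state R n) : R :=
  (lower s + upper s) / 2%:R.

Definition assort_init (R : realType) (n : nat) (n_gt0 : (0 < n)%N)
    (p : 'I_n -> R) : bs_state R n :=
  BsState 0 (p (Ordinal n_gt0)) [set Ordinal n_gt0].

(* One pass through the loop body.  It is nondeterministic: neither the
   maximizing set T nor the set S recorded after a successful test is unique. *)
Inductive assort_step (R : realType) (n : nat) (p v : 'I_n -> R) (v0 : R)
    (C : nat) (eps : R) (s : bs_state R n) : bs_state R n -> Prop :=
| AssortSuccess (T S : {set 'I_n}) :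
    eps < upper s - lower s ->
    top_choice p v C (midpoint s) T ->
    midpoint s <= v0^-1 * \sum_(i in T) gain p v (midpoint s) i ->
    feasible C S ->
    midpoint s <= revenue p v v0 S ->
    assort_step p v v0 C eps s (BsState (midpoint s) (upper s) S)
| AssortFailure (T : {set 'I_n}) :
    eps < upper s - lower s ->
    top_choice p v C (midpoint s) T ->
    v0^-1 * \sum_(i in T) gain p v (midpoint s) i < midpoint s ->
    assort_step p v v0 C eps s (BsState (lower s) (midpoint s) (best s)).

(* S can be returned by the loop started in state s. *)
Inductive assort_returns (R : realType) (n : nat) (p v : 'I_n -> R) (v0 : R)
    (C : nat) (eps : R) (s : bs_state R n) (S : {set 'I_n}) : Prop :=
| ReturnsStop :
    upper s - lower s <= eps -> best s = S ->
    assort_returns p v v0 C eps s S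
| ReturnsNext (s' : bs_state R n) :
    assort_step p v v0 C eps s s' ->
    assort_returns p v v0 C eps s' S ->
    assort_returns p v v0 C eps s S.

(* Total correctness: whatever choices are made, the loop started in state s
   never gets stuck, terminates, and returns a set satisfying Q. *)
Inductive assort_always (R : realType) (n : nat) (p v : 'I_n -> R) (v0 : R)
    (C : nat) (eps : R) (Q : {set 'I_n} -> Prop) (s : bs_state R n) : Prop :=
| AlwaysStop :
    upper s - lower s <= eps -> Q (best s) ->
    assort_always p v v0 C eps Q s
| AlwaysNext :
    (exists s', assort_step p v v0 C eps s s') ->
    (forall s', assort_step p v v0 C eps s s' ->
                assort_always p v v0 C eps Q s') ->
    assort_always p v v0 C eps Q s.

(* Real-RAM programs.  The memory consists of unbounded arrays, named by
   numerals, of natural numbers (indices) and of real numbers.  A program is a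
   finite piece of syntax independent of the input; the only way in which real
   data can influence control flow or index data is the comparison TLe. *)

Inductive iexpr : Type :=
| INum (k : nat)
| IGet (a : nat) (e : iexpr)
| IAdd (e1 e2 : iexpr)
| ISub (e1 e2 : iexpr)
| IMul (e1 e2 : iexpr)
| IDiv (e1 e2 : iexpr).

Inductive rexpr : Type :=
| RZero
| ROne
| RGet (a : nat) (e : iexpr)
| RAdd (x y : rexpr)
| RSub (x y : rexpr)
| RMul (x y : rexpr)
| RDiv (x y : rexpr).

Inductive test : Type :=
| TLe (x y : rexpr)
| TILe (e1 e2 : iexpr)
| TNot (b : test)
| TAnd (b1 b2 : test).

Inductive cmd : Type :=
| Skip
| ISet (a : nat) (e e' : iexpr)
| RSet (a : nat) (e : iexpr) (x : rexpr)
| Seq (c1 c2 : cmd)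
| If (b : test) (c1 c2 : cmd)
| While (b : test) (c : cmd).

Record memory (R : realType) := Memory {
  imem : nat -> nat -> nat;
  rmem : nat -> nat -> R
}.

Definition update (A : Type) (m : nat -> nat -> A) (a k : nat) (x : A)
    : nat -> nat -> A :=
  fun a' k' => if (a' == a) && (k' == k) then x else m a' k'.

Fixpoint ieval (m : nat -> nat -> nat) (e : iexpr) : nat :=
  match e with
  | INum k => k
  | IGet a e => m a (ieval m e)
  | IAdd e1 e2 => (ieval m e1 + ieval m e2)%N
  | ISub e1 e2 => (ieval m e1 - ieval m e2)%N
  | IMul e1 e2 => (ieval m e1 * ieval m e2)%N
  | IDiv e1 e2 => (ieval m e1 %/ ieval m e2)%N
  end.

(* Division by zero yields 0; a machine on which it is undefined simulates this
   with a constant number of additional comparisons per division. *)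
Fixpoint reval (R : realType) (m : memory R) (x : rexpr) : R :=
  match x with
  | RZero => 0
  | ROne => 1
  | RGet a e => rmem m a (ieval (imem m) e)
  | RAdd x y => reval m x + reval m y
  | RSub x y => reval m x - reval m y
  | RMul x y => reval m x * reval m y
  | RDiv x y => reval m x / reval m y
  end.

Fixpoint teval (R : realType) (m : memory R) (b : test) : bool :=
  match b with
  | TLe x y => reval m x <= reval m y
  | TILe e1 e2 => (ieval (imem m) e1 <= ieval (imem m) e2)%N
  | TNot b => ~~ teval m b
  | TAnd b1 b2 => teval m b1 && teval m b2
  end.

(* Time is the number of arithmetic operations on, and comparisons of, real
   numbers; index arithmetic and data movement are not counted.  Both sides of
   a conjunction are charged. *)
Fixpoint rcost (x : rexpr) : nat :=
  match x with
  | RZero | ROne | RGet _ _ => 0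
  | RAdd x y | RSub x y | RMul x y | RDiv x y => (rcost x + rcost y).+1
  end.

Fixpoint tcost (b : test) : nat :=
  match b with
  | TLe x y => (rcost x + rcost y).+1
  | TILe _ _ => 0
  | TNot b => tcost b
  | TAnd b1 b2 => tcost b1 + tcost b2
  end.

(* exec c m t m': started in memory m, the program c halts in memory m' after
   time t. *)
Inductive exec (R : realType) : cmd -> memory R -> nat -> memory R -> Prop :=
| ExecSkip m : exec Skip m 0 m
| ExecISet a e e' m :
    exec (ISet a e e') m 0
      (Memory (update (imem m) a (ieval (imem m) e) (ieval (imem m) e'))
              (rmem m))
| ExecRSet a e x m :
    exec (RSet a e x) m (rcost x)
      (Memory (imem m) (update (rmem m) a (ieval (imem m) e) (reval m x)))
| ExecSeq c1 c2 m t1 m1 t2 m2 :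
    exec c1 m t1 m1 -> exec c2 m1 t2 m2 ->
    exec (Seq c1 c2) m (t1 + t2) m2
| ExecIf b c1 c2 m t m' :
    exec (if teval m b then c1 else c2) m t m' ->
    exec (If b c1 c2) m (tcost b + t) m'
| ExecWhileStop b c m :
    ~~ teval m b -> exec (While b c) m (tcost b) m
| ExecWhileNext b c m t1 m1 t2 m2 :
    teval m b -> exec c m t1 m1 -> exec (While b c) m1 t2 m2 ->
    exec (While b c) m (tcost b + t1 + t2) m2.

Definition array_of (R : realType) (n : nat) (x : 'I_n -> R) (k : nat) : R :=
  if insub k is Some i then x i else 0.

(* Index array 0 holds n, C; real arrays 0, 1 and 2 hold the prices, the
   parameters v_1, ..., v_n, and v_0, eps; every other cell holds 0. *)
Definition input_memory (R : realType) (n : nat) (p v : 'I_n -> R) (v0 : R)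
    (C : nat) (eps : R) : memory R :=
  Memory
    (fun a k => match a with 0 => nth 0%N [:: n; C] k | _ => 0%N end)
    (fun a k => match a with
                | 0 => array_of p k
                | 1 => array_of v k
                | 2 => nth 0 [:: v0; eps] k
                | _ => 0
                end).

(* The output set is given by its characteristic vector in index array 1. *)
Definition output_set (R : realType) (n : nat) (m : memory R) : {set 'I_n} :=
  [set i : 'I_n | imem m 1 i != 0%N].

Definition log2 (R : realType) (x : R) : R := Num.max 1 (ln x / ln 2%:R).

(* Main.v *)
Require Import Defs.
From HB Require Import structures.
From mathcomp Require Import all_boot all_order all_algebra.
From mathcomp Require Import reals exp.
From mathcomp Require Import zify ring lra.

Set Implicit Arguments.
Unset Strict Implicit.
Unset Printing Implicit Defensive.

Import Order.TTheory GRing.Theory Num.Theory.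
Local Open Scope ring_scope.

(* The bracket [lower, upper] always contains the optimal revenue and halves at
   each pass, so about log2 (p_1 / eps) passes suffice.  Since K <= f(S) iff
   v_0 K <= sum_{i in S} v_i (p_i - K), one test amounts to maximizing a sum of
   gains over at most C items, which is done by taking the C largest positive
   gains.  The implementation keeps the best items seen so far in an array
   sorted by gain and inserts each item at a place found by binary search: as
   data movement is free, this costs O(log C) comparisons per item. *)

(** * Weakest preconditions with elapsed time for real-RAM programs *)

Section WeakestPrecondition.
Variable R : realType.
Implicit Types (m : memory R) (Q : nat -> memory R -> Prop).

(** The postcondition [Q] also receives the elapsed time, so one calculus covers termination,
    correctness and cost. A loop is not unfolded: its clause refers directly to [exec], which keeps
    the recursion structural and leaves loops to a separate invariant rule. *)
Fixpoint wp (c : cmd) Q m : Prop :=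
  match c with
  | Skip => Q 0%N m
  | ISet a e e' =>
      Q 0%N (Memory (update (imem m) a (ieval (imem m) e) (ieval (imem m) e'))
                    (rmem m))
  | RSet a e x =>
      Q (rcost x)
        (Memory (imem m) (update (rmem m) a (ieval (imem m) e) (reval m x)))
  | Seq c1 c2 => wp c1 (fun t1 => wp c2 (fun t2 => Q (t1 + t2)%N)) m
  | If b c1 c2 =>
      if teval m b then wp c1 (fun t => Q (tcost b + t)%N) m
      else wp c2 (fun t => Q (tcost b + t)%N) m
  | While b c' => exists t m', exec (While b c') m t m' /\ Q t m'
  end.

Lemma wp_exec c Q m : wp c Q m -> exists t m', exec c m t m' /\ Q t m'.
Proof.
elim: c Q m => [|a e e'|a e x|c1 IH1 c2 IH2|b c1 IH1 c2 IH2|b c _] Q m //=.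
- by exists 0%N, m; split=> //; exact: ExecSkip.
- by move=> q; do 2!eexists; split; first exact: ExecISet.
- by move=> q; do 2!eexists; split; first exact: ExecRSet.
- move=> /IH1[t1 [m1 [e1 /IH2[t2 [m2 [e2 q]]]]]].
  by exists (t1 + t2)%N, m2; split=> //; exact: ExecSeq e1 e2.
- move=> q.
  suff [t [m' [e' q']]] : exists t m',
      exec (if teval m b then c1 else c2) m t m' /\ Q (tcost b + t)%N m'.
    by exists (tcost b + t)%N, m'; split=> //; exact: ExecIf.
  by case: (teval m b) q => [/IH1|/IH2].
Qed.

Lemma exec_wp c Q m t m' : exec c m t m' -> Q t m' -> wp c Q m.
Proof.
move=> e; elim: e Q => {c m t m'} //=.
- by move=> c1 c2 m t1 m1 t2 m2 _ IH1 _ IH2 Q q; apply: IH1; apply: IH2.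
- by move=> b c1 c2 m t m' _ IH Q q; case: (teval m b) IH; apply.
- by move=> b c m nb Q q; exists (tcost b), m; split=> //; exact: ExecWhileStop.
- move=> b c m t1 m1 t2 m2 tb e1 _ e2 _ Q q.
  by do 2!eexists; split; first exact: ExecWhileNext tb e1 e2.
Qed.

Lemma wp_mono c Q Q' m :
  (forall t m', Q t m' -> Q' t m') -> wp c Q m -> wp c Q' m.
Proof. by move=> QQ' /wp_exec[t [m' [e q]]]; apply: exec_wp e _; apply: QQ'. Qed.

(** The index of [Inv] is a budget of remaining passes, which must be positive whenever the test
    succeeds. Each pass costs at most [tcost b + B]; the additional [tcost b] pays for the final
    failing test. *)
Lemma wp_while b c B (Inv : nat -> memory R -> Prop) k Q m :
  Inv k m ->
  (forall k m, Inv k m -> teval m b ->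
     (0 < k)%N /\ wp c (fun t m' => (t <= B)%N /\ Inv k.-1 m') m) ->
  (forall k' t m', Inv k' m' -> ~~ teval m' b ->
     (t <= k * (tcost b + B) + tcost b)%N -> Q t m') ->
  wp (While b c) Q m.
Proof.
move=> inv step post.
suff [t [m' [e tB [k' inv' nb]]]] : exists t m', [/\ exec (While b c) m t m',
    (t <= k * (tcost b + B) + tcost b)%N & exists2 k', Inv k' m' & ~~ teval m' b].
  by exists t, m'; split=> //; exact: post inv' nb tB.
elim: k m inv {post} => [|k IH] m inv; have [tb|nb] := boolP (teval m b).
- by have [] := step _ _ inv tb.
- exists (tcost b), m; split; [exact: ExecWhileStop|lia|by exists 0%N].
- have [_ /wp_exec[t1 [m1 [e1 [t1B inv1]]]]] := step _ _ inv tb.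
  have [t2 [m2 [e2 t2B end2]]] := IH _ inv1.
  exists (tcost b + t1 + t2)%N, m2; split=> //; last lia.
  exact: ExecWhileNext tb e1 e2.
- exists (tcost b), m; split; [exact: ExecWhileStop|lia|by exists k.+1].
Qed.

End WeakestPrecondition.

(** * Sorted lists of the largest positive gains *)

Section TopSequence.
Variables (R : realType) (g : nat -> R) (C : nat).
Implicit Types (s : seq nat).

Definition positive_below i := [seq x <- iota 0 i | 0 < g x].

(** List counterpart of [top_choice] for the items below [i]. The decreasing order is the extra
    condition that makes binary search possible. *)
Definition top_seq (i : nat) s :=
  [/\ uniq s, pairwise (fun x y => g y <= g x) s,
      {subset s <= positive_below i}, size s = minn C (size (positive_below i))
    & forall x y, x \in s -> y \in positive_below i -> y \notin s -> g y <= g x].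

Lemma positive_belowS i :
  positive_below i.+1 =
  if 0 < g i then rcons (positive_below i) i else positive_below i.
Proof.
by rewrite /positive_below -addn1 iotaD filter_cat add0n /=; case: ifP;
  rewrite ?cats0 ?cats1.
Qed.

Lemma top_seq_skip i s : g i <= 0 -> top_seq i s -> top_seq i.+1 s.
Proof. by move=> gi; rewrite /top_seq positive_belowS ltNge gi. Qed.

(** Inserting at a position that respects the order keeps the list sorted, and truncating to [C] can
    push out only its last element, which has the least gain. *)
Lemma top_seq_insert i s l :
  0 < g i -> top_seq i s ->
  (forall x, x \in take l s -> g i <= g x) ->
  (forall x, x \in drop l s -> g x <= g i) ->
  top_seq i.+1 (take C (take l s ++ i :: drop l s)).
Proof.
move=> gi [us ps ss szs tops] ge_i le_i; rewrite /top_seq positive_belowS gi.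
have ns : i \notin s.
  by apply/negP => /ss; rewrite mem_filter mem_iota add0n ltnn !andbF.
set s1 := take l s ++ i :: drop l s.
have p1 : perm_eq s1 (i :: s).
  by rewrite /s1 -[i :: drop l s]cat1s perm_catCA cat_take_drop.
have u1 : uniq s1 by rewrite (perm_uniq p1) /= ns.
have sz1 : size s1 = (size s).+1 by rewrite (perm_size p1).
have m1 x : (x \in s1) = (x == i) || (x \in s) by rewrite (perm_mem p1) in_cons.
have pw1 : pairwise (fun x y => g y <= g x) s1.
  move: ps; rewrite -{1}(cat_take_drop l s) !pairwise_cat => /and3P[a1 a2 a3].
  rewrite /= a2 a3 !andbT allrel_consr a1 andbT.
  by apply/andP; split; apply/allP => x; [exact: ge_i|exact: le_i].
have sub1 : {subset s1 <= rcons (positive_below i) i}.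
  move=> x; rewrite m1 mem_rcons in_cons => /orP[->//|/ss ->].
  by rewrite orbT.
(* Sortedness across the cut at [C]: every kept item has at least the gain of every dropped one. *)
have pwc := pw1; rewrite -(cat_take_drop C s1) pairwise_cat in pwc.
have {pwc} /and3P[/allrelP pwc pwt _] := pwc.
split.
- exact: take_uniq.
- exact: pwt.
- by move=> x /mem_take /sub1.
- by rewrite size_take_min sz1 szs size_rcons; lia.
- move=> x y xs' yp ys'.
  have xs1 := mem_take xs'.
  have [ys1|ys1] := boolP (y \in s1).
    apply: pwc => //; move: ys1.
    by rewrite -{1}(cat_take_drop C s1) mem_cat (negPf ys').
  move: ys1 yp; rewrite m1 mem_rcons in_cons => /norP[/negPf-> ys] /= yp.
  move: (xs1); rewrite m1 => /orP[/eqP xi|xs]; last exact: tops.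
  (* [y] was discarded, so [s] was full and insertion pushes out some [z] of [s]. *)
  have szC : size s = C.
    have : (size s < size (positive_below i))%N.
      have : uniq (y :: s) by rewrite /= ys.
      move=> /uniq_leq_size; apply=> z; rewrite in_cons => /orP[/eqP->//|].
      exact: ss.
    by rewrite szs; lia.
  have [z zd] : exists z, z \in drop C s1.
    have : size (drop C s1) = 1%N by rewrite size_drop sz1 szC; lia.
    by case: (drop C s1) => // z ? _; exists z; rewrite mem_head.
  have zs : z \in s.
    have := mem_drop zd; rewrite m1 => /orP[/eqP zi|//].
    move: u1; rewrite -(cat_take_drop C s1) cat_uniq => /and3P[_ /hasPn nn _].
    by have := nn _ zd; rewrite zi -xi xs'.
  by apply: le_trans (pwc _ _ xs' zd); exact: tops.
Qed.

End TopSequence.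

(** * The program *)

Definition cell (a : nat) : iexpr := IGet a (INum 0).
Definition setcell (a : nat) (e : iexpr) : cmd := ISet a (INum 0) e.
Definition lt_test (e1 e2 : iexpr) : test := TILe (IAdd e1 (INum 1)) e2.
Definition incr (a : nat) : cmd := setcell a (IAdd (cell a) (INum 1)).

(* Index arrays: 0 input, 1 output, 7 the selected items by decreasing gain;
   the cells 0 of the others are scalars: 2 the current item, 3 the number of
   selected items, 4 and 5 the bounds of the binary search, 6 a counter.
   Real arrays: 0, 1, 2 input, 3 lower bound, 4 upper bound, 5 midpoint,
   6 accumulator, 7 gains. *)

Definition search : cmd :=
  Seq (setcell 4 (INum 0)) (Seq (setcell 5 (cell 3))
  (While (lt_test (cell 4) (cell 5))
    (Seq (setcell 6 (IDiv (IAdd (cell 4) (cell 5)) (INum 2)))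
         (If (TLe (RGet 7 (cell 2)) (RGet 7 (IGet 7 (cell 6))))
             (setcell 4 (IAdd (cell 6) (INum 1)))
             (setcell 5 (cell 6)))))).

Definition insert : cmd :=
  Seq (setcell 6 (cell 3)) (Seq
  (While (lt_test (cell 4) (cell 6))
    (Seq (ISet 7 (cell 6) (IGet 7 (ISub (cell 6) (INum 1))))
         (setcell 6 (ISub (cell 6) (INum 1))))) (Seq
  (ISet 7 (cell 4) (cell 2))
  (If (lt_test (cell 3) (IGet 0 (INum 1))) (incr 3) Skip))).

Definition select : cmd :=
  Seq (setcell 3 (INum 0)) (Seq (setcell 2 (INum 0))
  (While (lt_test (cell 2) (IGet 0 (INum 0)))
    (Seq (RSet 7 (cell 2)
           (RMul (RGet 1 (cell 2)) (RSub (RGet 0 (cell 2)) (RGet 5 (INum 0)))))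
    (Seq (If (TNot (TLe (RGet 7 (cell 2)) RZero)) (Seq search insert) Skip)
         (incr 2))))).

Definition sum_gains : cmd :=
  Seq (RSet 6 (INum 0) RZero) (Seq (setcell 6 (INum 0))
  (While (lt_test (cell 6) (cell 3))
    (Seq (RSet 6 (INum 0)
            (RAdd (RGet 6 (INum 0)) (RGet 7 (IGet 7 (cell 6)))))
         (incr 6)))).

Definition record_best : cmd :=
  Seq (setcell 6 (INum 0)) (Seq
  (While (lt_test (cell 6) (IGet 0 (INum 0)))
    (Seq (ISet 1 (cell 6) (INum 0)) (incr 6))) (Seq
  (setcell 6 (INum 0))
  (While (lt_test (cell 6) (cell 3))
    (Seq (ISet 1 (IGet 7 (cell 6)) (INum 1)) (incr 6))))).

Definition assort_body : cmd :=
  Seq (RSet 5 (INum 0)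
        (RDiv (RAdd (RGet 3 (INum 0)) (RGet 4 (INum 0))) (RAdd ROne ROne)))
  (Seq select (Seq sum_gains
  (If (TLe (RGet 5 (INum 0)) (RDiv (RGet 6 (INum 0)) (RGet 2 (INum 0))))
      (Seq (RSet 3 (INum 0) (RGet 5 (INum 0))) record_best)
      (RSet 4 (INum 0) (RGet 5 (INum 0)))))).

Definition assort_loop : cmd :=
  While (TNot (TLe (RSub (RGet 4 (INum 0)) (RGet 3 (INum 0)))
                   (RGet 2 (INum 1)))) assort_body.

Definition assort_mnl : cmd :=
  Seq (RSet 4 (INum 0) (RGet 0 (INum 0)))
  (Seq (ISet 1 (INum 0) (INum 1)) assort_loop).

(** * Correctness and cost of the subroutines *)

Section Correctness.
Variable R : realType.
Implicit Types (m : memory R) (Q : nat -> memory R -> Prop).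

(** Frame condition: [xs] lists the index arrays that a program may modify. *)
Definition iframe (xs : seq nat) (I I' : nat -> nat -> nat) :=
  forall a, a \notin xs -> I' a = I a.

Lemma iframe_trans xs I I1 I2 :
  iframe xs I I1 -> iframe xs I1 I2 -> iframe xs I I2.
Proof. by move=> f1 f2 a na; rewrite f2 ?f1. Qed.

Lemma iframe_sub xs ys I I' :
  all [in ys] xs -> iframe xs I I' -> iframe ys I I'.
Proof. by move=> /allP xy f a na; apply: f; apply: contra na; exact: xy. Qed.

Lemma iframe_update xs a k e I I' :
  a \in xs -> iframe xs I I' -> iframe xs I (update I' a k e).
Proof.
move=> axs f b nb; rewrite -(f _ nb) /update /=.
by case: eqVneq => // ba; rewrite ba axs in nb.
Qed.

(** The insertion point always lies between the bounds in cells 4 and 5, whose distance stays below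
    [2 ^ k] with [k] passes left. A pass makes one real comparison, the loop test being free, hence
    at most [b] in all. *)
Lemma wp_search b Q m (A := imem m 7) (G := rmem m 7)
    (x := rmem m 7 (imem m 2 0)) (sz := imem m 3 0) :
  (forall j k, (j <= k < sz)%N -> G (A k) <= G (A j)) ->
  (sz < 2 ^ b)%N ->
  (forall t m', (t <= b)%N -> iframe [:: 4; 5; 6] (imem m) (imem m') -> rmem m' = rmem m ->
     (imem m' 4 0 <= sz)%N ->
     (forall j, (j < imem m' 4 0)%N -> x <= G (A j)) ->
     (forall j, (imem m' 4 0 <= j < sz)%N -> G (A j) <= x) -> Q t m') ->
  wp search Q m.
Proof.
move=> mono szb post; rewrite /search /=.
pose Inv k m' := [/\ iframe [:: 4; 5; 6] (imem m) (imem m'), rmem m' = rmem m,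
  (imem m' 4 0 <= imem m' 5 0 <= sz)%N && (imem m' 5 0 - imem m' 4 0 < 2 ^ k)%N,
  (forall j, (j < imem m' 4 0)%N -> x <= G (A j)) &
  (forall j, (imem m' 5 0 <= j < sz)%N -> G (A j) <= x)].
apply: (wp_while (B := 1) (Inv := Inv) (k := b)).
- split=> //.
  + by do 2!apply: iframe_update => //.
  + by rewrite /update /= leqnn /= subn0.
  + by move=> j; rewrite /update /=; case: leqP.
- move=> k [I r] [/= fr rr bd lo hi].
  have E2 : I 2%N = imem m 2 by exact: fr.
  have E7 : I 7%N = imem m 7 by exact: fr.
  set M := (_ %/ 2)%N => lh.
  have -> : update I 6 0 M 2%N = imem m 2%N := E2.
  have -> : update I 6 0 M 7%N = imem m 7%N := E7.
  have -> : update I 6 0 M 6%N 0%N = M by [].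
  have frM e a : a \in [:: 4; 5] ->
      iframe [:: 4; 5; 6] (imem m) (update (update I 6 0 M) a 0 e).
    by rewrite !inE => a45; apply: iframe_update;
      [rewrite !inE; lia|exact: iframe_update].
  (* For [k = 0] the distance of the bounds would be 0, against the loop test. *)
  have k0 : (0 < k)%N by case: (k) bd => //; lia.
  have kE : (2 ^ k = 2 * 2 ^ k.-1)%N by rewrite -expnS prednK.
  (* These bounds on the rounded midpoint make either remaining half shorter than [2 ^ k.-1]. *)
  have dM : (2 * M <= I 4 0 + I 5 0 < 2 * M.+1)%N.
    by rewrite mulnC leq_trunc_div mulnC; exact: ltn_ceil.
  rewrite rr -/A -/G -/x; split=> //.
  case: (lerP x (G (A M))) => cmp; split=> //; split=> //=.
  + exact: frM.
  + by rewrite /update /=; lia.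
  + move=> j; rewrite /update /= => jM; apply: le_trans cmp (mono _ _ _); lia.
  + exact: frM.
  + by rewrite /update /=; lia.
  + rewrite /update /= => j jM.
    by apply: le_trans (mono _ _ _) (ltW cmp); lia.
- move=> k t m' [fr rr bd lo hi] /=; rewrite -ltnNge => nb tb.
  apply: post => //; first lia.
  + lia.
  + by move=> j jb; apply: hi; lia.
Qed.
Opaque search.

(** The tail is shifted by one place, from the right end down to [l], and the item is written into
    the gap. If the list was already full, its size is not increased, so the last entry falls
    outside: this is the truncation [take C]. Only indices move, so the time is 0. *)
Lemma wp_insert Q m (A := imem m 7) (sz := imem m 3 0) (l := imem m 4 0)
    (C := imem m 0 1) (s := mkseq A sz) :
  (sz <= C)%N -> (l <= sz)%N ->
  (forall m', iframe [:: 3; 6; 7] (imem m) (imem m') -> rmem m' = rmem m ->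
     mkseq (imem m' 7) (imem m' 3 0) =
       take C (take l s ++ imem m 2 0 :: drop l s) -> Q 0%N m') ->
  wp insert Q m.
Proof.
move=> szC lsz post; rewrite /insert /=.
(* [k] entries of the tail are still to be shifted; those to the right of [l + k] already are. *)
pose Inv k m' := [/\ iframe [:: 6; 7] (imem m) (imem m'), rmem m' = rmem m,
  imem m' 6 0 = (l + k)%N /\ (l + k <= sz)%N &
  forall j, imem m' 7 j = if (l + k < j <= sz)%N then A j.-1 else A j].
apply: (wp_while (B := 0) (Inv := Inv) (k := (sz - l)%N)).
- split=> //=; first exact: iframe_update.
    by rewrite /update /=; split; lia.
  by move=> j; rewrite /update /= -/(A j); case: ifP => //; lia.
- move=> k [I r] [/= fr rr [I6 lk] I7].
  have -> : I 4%N = imem m 4 by exact: fr.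
  rewrite I6 -/l => kl; have k0 : (0 < k)%N by lia.
  split=> //; split=> //; split=> //=.
  + by do 2!apply: iframe_update => //.
  + by rewrite /update /= I6; split; lia.
  + move=> j; rewrite /update /=; case: eqVneq => [->|jk].
      by rewrite I7; do 2!case: ifP; rewrite ?subn1 //; lia.
    by rewrite I7; do 2!case: ifP => //; lia.
- move=> k t [I r] [/= fr rr [I6 lk] I7]; rewrite -ltnNge => nb tB.
  have t0 : t = 0%N by lia.
  have k0 : k = 0%N.
    by move: nb; rewrite (fr 4%N) // I6 -/l; lia.
  rewrite t0 /=; move: I7 I6 {nb tB lk}; rewrite k0 addn0 => I7 I6.
  have -> : I 4%N = imem m 4 by exact: fr.
  have -> : I 2%N = imem m 2 by exact: fr.
  rewrite -/l.
  set A' := update I 7 l (imem m 2 0).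
  have E (x : nat) : x != 7%N -> A' x = I x.
    by move=> x7; rewrite /A' /update (negPf x7).
  rewrite !(E 3%N) // !(E 0%N) //.
  have -> : I 3%N = imem m 3 by exact: fr.
  have -> : I 0%N = imem m 0 by exact: fr.
  rewrite -/sz -/C.
  have frA : iframe [:: 3; 6; 7] (imem m) A'.
    by apply: iframe_update => //; exact: iframe_sub fr.
  have seqE k' : (k' = minn C sz.+1)%N -> mkseq (A' 7) k' =
      take C (take l s ++ imem m 2 0 :: drop l s).
    move=> k'E; apply: (@eq_from_nth _ 0%N).
      rewrite size_mkseq size_take_min size_cat /= size_takel ?size_drop size_mkseq; lia.
    rewrite size_mkseq => j jk; rewrite nth_mkseq // nth_take; last lia.
    rewrite nth_cat size_takel ?size_mkseq // /A' /update /=.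
    case: ltnP => lj.
      rewrite nth_take // nth_mkseq; last lia.
      by case: eqVneq => [|_]; [lia|rewrite I7; case: ifP => //; lia].
    case: eqVneq => [->|ne]; first by rewrite subnn.
    have -> : (j - l = (j - l).-1.+1)%N by lia.
    rewrite /= nth_drop nth_mkseq; last lia.
    rewrite I7 ifT; last lia.
    by congr (A _); lia.
  case: ifP => szC'; apply: post => //=.
  + exact: iframe_update.
  + by apply: seqE; rewrite /update /=; lia.
  + by rewrite (E 3%N) // (fr 3%N) // -/sz; apply: seqE; lia.
Qed.

Opaque insert.

(** Per item: two operations for the gain, one comparison with 0, and at most [b] comparisons in the
    search, since the list never exceeds [C < 2 ^ b] entries. *)
Lemma wp_select b Q m (n := imem m 0 0) (C := imem m 0 1) (K := rmem m 5 0)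
    (g := fun k => rmem m 1 k * (rmem m 0 k - K)) :
  (C < 2 ^ b)%N ->
  (forall t m', (t <= n * (b + 3))%N ->
     iframe [:: 2; 3; 4; 5; 6; 7] (imem m) (imem m') ->
     (forall a : nat, a != 7%N -> rmem m' a = rmem m a) ->
     top_seq g C n (mkseq (imem m' 7) (imem m' 3 0)) ->
     (forall x, (x < n)%N -> rmem m' 7 x = g x) -> Q t m') ->
  wp select Q m.
Proof.
move=> Cb post; rewrite /select /=.
pose Inv k m' := [/\ iframe [:: 2; 3; 4; 5; 6; 7] (imem m) (imem m'),
  (forall a : nat, a != 7%N -> rmem m' a = rmem m a), (imem m' 2 0 + k = n)%N,
  top_seq g C (imem m' 2 0) (mkseq (imem m' 7) (imem m' 3 0)) &
  (forall x, (x < imem m' 2 0)%N -> rmem m' 7 x = g x)].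
apply: (wp_while (B := (b + 3)%N) (Inv := Inv) (k := n)).
- split=> //=; first by do 2!apply: iframe_update => //.
- move=> k [I r] [/= fr rr I2 top r7].
  have -> : I 0%N = imem m 0 by exact: fr.
  rewrite -/n => lt; split; first lia.
  set i := I 2%N 0%N.
  set r' := update r 7 i _.
  have r'E (a : nat) : a != 7%N -> r' a = rmem m a.
    by move=> a7; rewrite /r' /update (negPf a7) -rr.
  have r'7 x : (x < i.+1)%N -> r' 7%N x = g x.
    rewrite /r' /update /=; case: eqVneq => [-> _|xi xlt].
      by rewrite !rr.
    by rewrite r7 //; rewrite -/i; lia.
  have szC : (I 3%N 0%N <= C)%N.
    by case: (top) => _ _ _; rewrite size_mkseq => -> _; exact: geq_minl.
  rewrite r'7 //; case: (lerP (g i) 0) => gi /=.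
    split; first lia.
    split=> //=.
    + exact: iframe_update.
    + by rewrite /update /= -/i; lia.
    + by rewrite {1}/update /= addn1; exact: top_seq_skip.
    + by move=> x; rewrite /update /= addn1; exact: r'7.
  set s := mkseq _ _ in top.
  have sA j : (j < I 3 0)%N -> nth 0%N s j = I 7%N j by move=> jn; rewrite nth_mkseq.
  have sz_s : size s = I 3%N 0%N by rewrite size_mkseq.
  have s_lt x : x \in s -> (x < i)%N.
    by case: top => _ _ ss _ _ /ss; rewrite mem_filter mem_iota => /andP[_].
  (* Listed items precede the current one, so their gains have already been stored in array 7. *)
  have r'A j : (j < I 3 0)%N -> r' 7%N (I 7%N j) = g (nth 0%N s j).
    move=> jn; rewrite sA // r'7 //; apply/ltnW; rewrite ltnS.
    by rewrite -sA // s_lt // mem_nth // sz_s.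
  apply: (wp_search (b := b)) => /=.
  + move=> j l /andP[jl ln]; have jn := leq_ltn_trans jl ln.
    rewrite !r'A //; move: jl; rewrite leq_eqVlt => /predU1P[->//|jl].
    case: top => _ /(pairwiseP 0%N) pw _ _ _.
    by apply: (pw j l) => //; rewrite inE sz_s.
  + exact: leq_ltn_trans Cb.
  + move=> t [I1 r1] /= tb fr1 -> {r1} ll ge_l le_l.
    have I17 : I1 7%N = I 7%N by exact: fr1.
    have I13 : I1 3%N = I 3%N by exact: fr1.
    have I12 : I1 2%N = I 2%N by exact: fr1.
    have I10 : I1 0%N = imem m 0 by rewrite (fr1 0%N) // (fr 0%N).
    apply: wp_insert => /=; rewrite ?I13 ?I10 //.
    rewrite I17 I12 -/i -/s -/C => -[I2' r2] /= fr2 -> E2 {r2}.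
    have I22 : I2' 2%N = I 2%N by rewrite (fr2 2%N) // I12.
    split; first lia.
    split=> //=.
    * apply: iframe_update => //.
      apply: iframe_trans (iframe_trans fr _) _; last exact: iframe_sub fr2.
      exact: iframe_sub fr1.
    * by rewrite /update /= I22; lia.
    * rewrite {1}/update /= I22 addn1 -/i.
      have -> : update I2' 2 0 i.+1 7 = I2' 7%N by [].
      have -> : update I2' 2 0 i.+1 3 = I2' 3%N by [].
      rewrite E2; apply: top_seq_insert => // x.
        move=> /(nthP 0%N)[j]; rewrite size_takel ?sz_s // => jl.
        rewrite nth_take // => <-; have jn := leq_trans jl ll.
        by rewrite -r'A // -(r'7 i) //; exact: ge_l.
      move=> /(nthP 0%N)[j]; rewrite size_drop sz_s => jl.
      rewrite nth_drop => <-.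
      by rewrite -r'A -?(r'7 i) //; [apply: le_l|]; lia.
    * by move=> x; rewrite /update /= I22 addn1 -/i; exact: r'7.
- move=> k t m' [fr rr I2 top r7]; rewrite /= -ltnNge => nb tB.
  have -> : (0 + (0 + t) = t)%N by [].
  have I2n : imem m' 2 0 = n by move: nb; rewrite (fr 0%N) // -/n; lia.
  rewrite I2n in top r7.
  by apply: post => //; rewrite /= in tB; lia.
Qed.

Opaque select.

Lemma wp_sum_gains Q m (s := mkseq (imem m 7) (imem m 3 0)) :
  (forall t m', (t <= imem m 3 0)%N -> iframe [:: 6] (imem m) (imem m') ->
     (forall a : nat, a != 6%N -> rmem m' a = rmem m a) ->
     rmem m' 6 0 = \sum_(x <- s) rmem m 7 x -> Q t m') ->
  wp sum_gains Q m.
Proof.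
move=> post; rewrite /sum_gains /=.
pose Inv k m' := [/\ iframe [:: 6] (imem m) (imem m'),
  (forall a : nat, a != 6%N -> rmem m' a = rmem m a),
  (imem m' 6 0 + k = imem m 3 0)%N &
  rmem m' 6 0 = \sum_(0 <= j < imem m' 6 0) rmem m 7 (imem m 7 j)].
apply: (wp_while (B := 1) (Inv := Inv) (k := imem m 3 0)).
- split=> //=; first exact: iframe_update.
    by move=> a a6; rewrite /update (negPf a6).
  by rewrite /update /= big_geq.
- move=> k [I r] [/= fr rr I6 r6].
  have -> : I 3%N = imem m 3 by exact: fr.
  move=> lt; split; first lia.
  split=> //; split=> //=.
  + exact: iframe_update.
  + by move=> a a6; rewrite /update (negPf a6) -rr.
  + by rewrite /update /=; lia.
  + by rewrite /update /= addn1 big_nat_recr //= r6 rr // (fr 7%N).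
- move=> k t [I r] [/= fr rr I6 r6].
  have -> : I 3%N = imem m 3 by exact: fr.
  rewrite -ltnNge => nb tB.
  have I6n : I 6%N 0%N = imem m 3 0 by lia.
  apply: post => //=; first lia.
  by rewrite r6 I6n /s /mkseq big_map /index_iota subn0.
Qed.

Opaque sum_gains.

(** The previously recorded set is erased by a first loop before the new one is marked by a second;
    neither touches real data. *)
Lemma wp_record_best Q m (s := mkseq (imem m 7) (imem m 3 0)) :
  (forall m', iframe [:: 1; 6] (imem m) (imem m') -> rmem m' = rmem m ->
     (forall j, (j < imem m 0 0)%N -> imem m' 1 j = (j \in s)) -> Q 0%N m') ->
  wp record_best Q m.
Proof.
move=> post; rewrite /record_best /=.
pose Inv1 k m' := [/\ iframe [:: 1; 6] (imem m) (imem m'), rmem m' = rmem m,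
  (imem m' 6 0 + k = imem m 0 0)%N &
  forall j, (j < imem m' 6 0)%N -> imem m' 1 j = 0%N].
apply: (wp_while (B := 0) (Inv := Inv1) (k := imem m 0 0)).
- by split=> //=; exact: iframe_update.
- move=> k [I r] [/= fr rr I6 I1].
  have -> : I 0%N = imem m 0 by exact: fr.
  move=> lt; split; first lia.
  split=> //; split=> //=.
  + by do 2!apply: iframe_update => //.
  + by rewrite /update /=; lia.
  + move=> j; rewrite /update /= addn1 ltnS leq_eqVlt => /predU1P[->|jl].
      by rewrite eqxx.
    by case: eqVneq => // _; exact: I1.
move=> k0 t0 [I0 r0] [/= fr0 -> I06 I01] {r0}.
have -> : I0 0%N = imem m 0 by exact: fr0.
rewrite -ltnNge => nb0 t0B.
have I06n : I0 6%N 0%N = imem m 0 0 by lia.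
have {t0B} -> : t0 = 0%N by lia.
pose Inv k m' := [/\ iframe [:: 1; 6] (imem m) (imem m'), rmem m' = rmem m,
  (imem m' 6 0 + k = imem m 3 0)%N &
  forall j, (j < imem m 0 0)%N -> imem m' 1 j = (j \in take (imem m' 6 0) s)].
have sz_s : size s = imem m 3 0 by rewrite size_mkseq.
apply: (wp_while (B := 0) (Inv := Inv) (k := imem m 3 0)).
- split=> //=; first exact: iframe_update.
  by move=> j jn; rewrite /update /= take0 /= I01 // I06n.
- move=> k [I r] [/= fr rr I6 I1].
  have -> : I 3%N = imem m 3 by exact: fr.
  move=> lt; split; first lia.
  split=> //; split=> //=.
  + by do 2!apply: iframe_update => //.
  + by rewrite /update /=; lia.
  + move=> j jn; rewrite /update /= addn1.
    rewrite (take_nth 0%N) ?sz_s; last lia.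
    rewrite mem_rcons in_cons nth_mkseq; last lia.
    rewrite (fr 7%N) //.
    by case: eqVneq => //= _; exact: I1.
- move=> k t [I r] [/= fr rr I6 I1].
  have -> : I 3%N = imem m 3 by exact: fr.
  rewrite -ltnNge => nb tB.
  have -> : t = 0%N by lia.
  apply: post => //= j jn; rewrite I1 // take_oversize // sz_s; lia.
Qed.

Opaque record_best.

End Correctness.

(** * Revenue, gains and the optimality of the greedy choice *)

Section Model.
Variables (R : realType) (n : nat) (p v : 'I_n -> R) (v0 : R) (C : nat).
Implicit Types (S T : {set 'I_n}) (K : R).

(** Averaging replaces an injection of [A] into [B]: summing [g j <= g i] over all pairs gives
    [#|B|] times the sum over [A] at most [#|A|] times the sum over [B], and the latter sum is
    nonnegative. *)
Lemma ler_sum_exchange (I : finType) (g : I -> R) (A B : {set I}) :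
  (#|A| <= #|B|)%N ->
  (forall i j, i \in B -> j \in A -> g j <= g i) ->
  (forall i, i \in B -> 0 <= g i) ->
  \sum_(i in A) g i <= \sum_(i in B) g i.
Proof.
move=> AB le_g ge0.
have B0 : 0 <= \sum_(i in B) g i by apply: sumr_ge0.
have [B_eq0|B_gt0] := posnP #|B|.
  have A0 : A = set0 by apply/eqP; rewrite -cards_eq0; lia.
  by rewrite A0 big_set0.
rewrite -(ler_pM2l (_ : 0 < #|B|%:R)) ?ltr0n //.
apply: (@le_trans _ _ (#|A|%:R * \sum_(i in B) g i)); last first.
  by apply: ler_wpM2r; rewrite ?ler_nat.
rewrite !mulr_natl -!sumr_const [X in _ <= X]exchange_big /=.
by apply: ler_sum => i iB; apply: ler_sum => j jA; exact: le_g.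
Qed.

(** Discarding the items of nonpositive gain from [S] does not decrease its sum. The part shared
    with [T] then cancels, and the two differences are compared by exchange. *)
Lemma top_choice_max K S T :
  top_choice p v C K T -> feasible C S ->
  \sum_(i in S) gain p v K i <= \sum_(i in T) gain p v K i.
Proof.
case=> Tpos cT topT SC; set pos := [set _ | _] in Tpos cT topT.
set g := gain p v K.
apply: (@le_trans _ _ (\sum_(i in S :&: pos) g i)).
  rewrite [X in X <= _](big_setID pos) /= -[X in _ <= X]addr0 lerD2l.
  by apply: sumr_le0 => i; rewrite !inE -leNgt => /andP[].
rewrite (big_setID T) [X in _ <= X](big_setID (S :&: pos)) /= setIC lerD2l.
have S_T : (#|S :&: pos| <= #|T|)%N.
  by rewrite cT leq_min (leq_trans (subset_leq_card (subsetIl _ _)) SC)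
    subset_leq_card ?subsetIr.
apply: ler_sum_exchange => [|i j|i].
- by rewrite !cardsD [_ :&: T]setIC leq_sub2r.
- by rewrite !inE => /andP[_ iT] /andP[jT /andP[_ jp]]; apply: topT; rewrite ?inE.
- by move=> /setDP[/(subsetP Tpos)]; rewrite inE => /ltW.
Qed.

(** Bridge from the program's lists of numerals to sets of ordinals: [s] is a permutation of the
    values enumerated by the set. *)
Lemma top_seq_top_choice K (g : nat -> R) s :
  (forall i : 'I_n, g i = gain p v K i) -> top_seq g C n s ->
  top_choice p v C K [set i : 'I_n | val i \in s] /\
  \sum_(x <- s) g x = \sum_(i in [set i : 'I_n | val i \in s]) gain p v K i.
Proof.
move=> gE [us _ ss szs tops]; set T := [set i | _].
have posE (i : 'I_n) : (val i \in positive_below g n) = (0 < gain p v K i).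
  by rewrite mem_filter mem_iota /= add0n ltn_ord andbT gE.
have sT : perm_eq s [seq val i | i <- enum T].
  apply: uniq_perm => //; first by rewrite map_inj_uniq ?enum_uniq //; exact: val_inj.
  move=> x; apply/idP/mapP => [xs|[i iT ->]]; last first.
    by move: iT; rewrite mem_enum inE.
  have := ss _ xs; rewrite mem_filter mem_iota add0n => /and3P[_ _ xn].
  by exists (Ordinal xn) => //; rewrite mem_enum inE.
have sumT : \sum_(x <- s) g x = \sum_(i in T) gain p v K i.
  rewrite (perm_big _ sT) big_map big_enum.
  by apply: eq_bigr => i _; rewrite gE.
split=> //; split.
- by apply/subsetP => i; rewrite !inE => /ss; rewrite posE.
- rewrite cardE -(size_map val) -(perm_size sT) szs; congr minn.
  rewrite cardE -(size_map val (enum _)); apply/perm_size/uniq_perm.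
  + exact/filter_uniq/iota_uniq.
  + by rewrite map_inj_uniq ?enum_uniq //; exact: val_inj.
  + move=> x; apply/idP/mapP => [xp|[i]]; last first.
      by rewrite mem_enum inE -posE => ? ->.
    have := xp; rewrite mem_filter mem_iota add0n => /and3P[_ _ xn].
    by exists (Ordinal xn) => //; rewrite mem_enum inE -posE.
- move=> i j; rewrite !inE => iT jp jT.
  by rewrite -!gE; apply: tops => //; rewrite posE.
Qed.

(* Obtained by running [select]. *)
Lemma top_choice_exists K : exists T, top_choice p v C K T.
Proof.
(* All real arrays other than 0 and 1 are constantly [K], so the threshold that [select] reads in
   array 5 is [K]. *)
pose m := Memory (fun _ k => nth 0%N [:: n; C] k)
  (fun a k => match a with 0 => array_of p k | 1 => array_of v k | _ => K end).
have [_ [_ [_ [s top]]]] : exists t m', exec select m t m' /\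
    exists s, top_seq (fun k => array_of v k * (array_of p k - K)) C n s.
  apply: (wp_exec (Q := fun _ _ => _)); apply: (wp_select (b := C)).
    exact: ltn_expl.
  by move=> *; eexists; eassumption.
have gE (i : 'I_n) : array_of v i * (array_of p i - K) = gain p v K i.
  by rewrite /array_of valK.
by have [] := top_seq_top_choice gE top; eexists; eassumption.
Qed.

Hypotheses (v0_gt0 : 0 < v0) (v_ge0 : forall i, 0 <= v i).

Lemma denominator_gt0 S : 0 < v0 + \sum_(i in S) v i.
Proof. by rewrite ltr_wpDr // sumr_ge0. Qed.

Lemma le_revenue K S :
  (K <= revenue p v v0 S) = (K <= v0^-1 * \sum_(i in S) gain p v K i).
Proof.
rewrite /revenue ler_pdivlMr ?denominator_gt0 // ler_pdivlMl //.
have -> : \sum_(i in S) gain p v K i =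
    \sum_(i in S) p i * v i - K * \sum_(i in S) v i.
  rewrite mulr_sumr -sumrB; apply: eq_bigr => i _; rewrite /gain; ring.
by rewrite mulrDr lerBrDr mulrC.
Qed.

End Model.

(** The witness is the integer part of the binary logarithm plus one; as [log2] is at least 1 by
    definition, the factor 2 absorbs the added one. *)
Lemma exists_pow2_gt (R : realType) (x : R) :
  1 <= x -> exists k : nat, x < 2%:R ^+ k /\ k%:R <= 2%:R * log2 x.
Proof.
move=> x1; have ln2 : 0 < ln (2%:R : R) by apply: ln_gt0; rewrite ltr1n.
set y := ln x / ln 2%:R.
have y0 : 0 <= y by rewrite divr_ge0 ?(ltW ln2) ?ln_ge0.
exists (Num.truncn y).+1; split.
  rewrite -ltr_ln ?posrE ?exprn_gt0 //; last exact: lt_le_trans x1.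
  by rewrite lnXn // -[ln _ *+ _]mulr_natl -ltr_pdivrMr // truncnS_gt.
have := truncn_le y; rewrite y0 -natr1 => ky.
rewrite mulr_natl mulr2n lerD //; last by rewrite /log2 le_max lexx.
by apply: le_trans ky _; rewrite /log2 le_max lexx orbT.
Qed.

(** * The binary search and its simulation by the program *)

Section Algorithm.
Variables (R : realType) (n : nat) (p v : 'I_n -> R).
Variables (v0 : R) (C : nat) (eps : R).
Hypotheses (v0_gt0 : 0 < v0) (v_ge0 : forall i, 0 <= v i).
Implicit Types (s : bs_state R n) (m : memory R) (S T : {set 'I_n}).

Lemma top_choice_feasible K T : top_choice p v C K T -> feasible C T.
Proof. by case=> _ cT _; rewrite /feasible cT geq_minl. Qed.

Lemma assort_step_exists s :
  eps < upper s - lower s -> exists s', assort_step p v v0 C eps s s'.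
Proof.
move=> gap; have [T topT] := top_choice_exists p v C (midpoint s).
have [le|lt] := lerP (midpoint s) (v0^-1 * \sum_(i in T) gain p v (midpoint s) i).
  eexists; apply: (AssortSuccess gap topT le (top_choice_feasible topT) _).
  by rewrite le_revenue.
by eexists; apply: AssortFailure gap topT lt.
Qed.

Lemma assort_step_halves s s' : assort_step p v v0 C eps s s' ->
  upper s' - lower s' = (upper s - lower s) / 2%:R.
Proof. by case=> * /=; rewrite /midpoint; field. Qed.

Definition assort_inv s :=
  [/\ feasible C (best s), lower s <= revenue p v v0 (best s) &
      forall S, feasible C S -> revenue p v v0 S <= upper s].

Lemma assort_step_inv s s' :
  assort_step p v v0 C eps s s' -> assort_inv s -> assort_inv s'.
Proof.
case=> [T S _ _ _ fS leS|T _ topT lt] [fb lb ub]; split=> //= S fS.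
(* Failed test: a feasible [S] with revenue above the midpoint would satisfy the linearized
   inequality, and so would [T], whose sum of gains is at least as large. *)
rewrite leNgt; apply/negP => /ltW; rewrite le_revenue // => le.
suff leT : v0^-1 * \sum_(i in S) gain p v (midpoint s) i <=
    v0^-1 * \sum_(i in T) gain p v (midpoint s) i.
  by have := le_lt_trans le (le_lt_trans leT lt); rewrite ltxx.
by rewrite ler_pM2l ?invr_gt0 //; exact: top_choice_max topT fS.
Qed.

(** [k] bounds the remaining halvings. On exit, the maximum is at most [upper], hence at most
    [lower + eps], and [lower] is attained or exceeded by the recorded set. *)
Lemma assort_inv_always k s :
  assort_inv s -> upper s - lower s <= eps * 2%:R ^+ k ->
  assort_always p v v0 C eps
    (fun S => feasible C S /\ max_revenue p v v0 C - eps <= revenue p v v0 S) s.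
Proof.
have stop s' : assort_inv s' -> upper s' - lower s' <= eps ->
    max_revenue p v v0 C - eps <= revenue p v v0 (best s').
  move=> [_ lb ub] gap; suff max_ub : max_revenue p v v0 C <= upper s' by lra.
  by apply: bigmax_le => //; apply: ub; rewrite /feasible cards0.
elim: k s => [|k IH] s inv gapk; have [gap|gap] := lerP (upper s - lower s) eps;
  try by apply: AlwaysStop => //; split; [case: inv|exact: stop].
  by move: gapk; rewrite expr0 mulr1 leNgt gap.
apply: AlwaysNext => [|s' step]; first exact: assort_step_exists.
apply: IH; first exact: assort_step_inv step inv.
by rewrite (assort_step_halves step) ler_pdivrMr // -mulrA -exprSr.
Qed.

Let input := input_memory p v v0 C eps.

Definition has_input m :=
  imem m 0 = imem input 0 /\ (forall a, (a < 3)%N -> rmem m a = rmem input a).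

(** Abstraction map through which each pass of the program simulates one [assort_step]. *)
Definition state_of m : bs_state R n :=
  BsState (rmem m 3 0) (rmem m 4 0) (output_set n m).

Lemma output_setE m m' : imem m' 1 = imem m 1 -> output_set n m' = output_set n m.
Proof. by move=> E; apply/setP => i; rewrite !inE E. Qed.

Opaque select sum_gains record_best.

(** Cost: 3 for the midpoint, [n * (b + 3)] for the selection, at most [C <= n] additions for the
    sum of gains, and 2 for the division and the comparison in the test. *)
Lemma wp_assort_body b Q m :
  (C <= n)%N -> (C < 2 ^ b)%N -> has_input m ->
  eps < rmem m 4 0 - rmem m 3 0 ->
  (forall t m', (t <= n * (b + 4) + 5)%N -> has_input m' ->
     assort_step p v v0 C eps (state_of m) (state_of m') -> Q t m') ->
  wp assort_body Q m.
Proof.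
move=> Cn Cb [I0 r0] gap post; case: m I0 r0 gap post => I r /= I0 r0 gap post.
rewrite /assort_body /=; set K := _ / _.
have KE : K = midpoint (state_of (Memory I r)) by [].
set r1 := update r 5 0 K.
apply: (wp_select (b := b)) => /=; rewrite I0 //=.
move=> t1 [I2 r2] /= t1B fr2 rr2 top r27.
set s := mkseq _ _ in top.
apply: wp_sum_gains => t2 [I3 r3] /= t2B fr3 rr3 r36.
set g := fun k => _ in top r27.
have gE (i : 'I_n) : g i = gain p v (midpoint (state_of (Memory I r))) i.
  by rewrite -KE /g /r1 /update /= !r0 //= /array_of valK.
have [topT sumT] := top_seq_top_choice gE top.
set T := [set _ | _] in topT sumT.
have szC : (I2 3 0 <= C)%N.
  by case: (top) => _ _ _; rewrite size_mkseq => ->; rewrite geq_minl.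
have r3E a : a != 6%N -> a != 7%N -> r3 a = r1 a by move=> a6 a7; rewrite rr3 // rr2.
have I30 : I3 0%N = imem input 0 by rewrite (fr3 0%N) // (fr2 0%N).
have I31 : I3 1%N = I 1%N by rewrite (fr3 1%N) // (fr2 1%N).
have r35 : r3 5%N 0%N = K by rewrite r3E.
have r32 : r3 2%N 0%N = v0 by rewrite r3E // /r1 /update /= r0.
have {r36} r36 : r3 6%N 0%N =
    \sum_(i in T) gain p v (midpoint (state_of (Memory I r))) i.
  rewrite r36 -sumT big_seq [RHS]big_seq; apply: eq_bigr => x xs.
  rewrite r27 //; case: top => _ _ /(_ _ xs).
  by rewrite mem_filter mem_iota => /and3P[].
rewrite r35 r32 r36 [_ / v0]mulrC.
case: ifPn => [le|]; last first.
  rewrite -ltNge => lt; apply: post => /=.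
  - lia.
  - split=> //= a a3; rewrite -r0 // /update; case: eqVneq a3 => [->//|a4 a3].
    rewrite r3E; try lia.
    by rewrite /r1 /update; case: eqVneq a3 => [->|].
  - suff -> : state_of (Memory I3 (update r3 4 0 K)) =
        BsState (r 3%N 0%N) K (output_set n (Memory I r)).
      exact: (AssortFailure (s := state_of (Memory I r)) gap topT lt).
    rewrite /state_of /=; congr BsState; last exact: output_setE.
    by rewrite /update /= r3E.
apply: wp_record_best => /= -[I4 r4] /= fr4 -> I41 {r4}.
have I40 : I4 0%N = imem input 0 by rewrite (fr4 0%N).
apply: post => /=.
- lia.
- split=> //= a a3; rewrite -r0 // /update; case: eqVneq a3 => [->//|a4 a3].
  rewrite r3E; try lia.
  by rewrite /r1 /update; case: eqVneq a3 => [->|].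
- have outT : output_set n (Memory I4 (update r3 3 0 K)) = T.
    apply/setP => i; rewrite !inE /= I41 ?I30 //.
    by rewrite /s (fr3 7%N) // (fr3 3%N) //; case: (_ \in _).
  suff -> : state_of (Memory I4 (update r3 3 0 K)) = BsState K (r 4%N 0%N) T.
    apply: (AssortSuccess (s := state_of (Memory I r)) gap topT le
      (top_choice_feasible topT)).
    by rewrite le_revenue.
  rewrite /state_of /= outT; congr BsState.
  by rewrite /update /= r3E.
Qed.

Opaque assort_body.

(** The invariant carries returnability backwards: whatever the abstract loop can return from the
    current state, it can return from the initial one. The loop test costs 2, which turns 5 into 7
    per pass and leaves 2 for the exit. *)
Lemma wp_assort_loop b k Q m :
  (C <= n)%N -> (C < 2 ^ b)%N -> has_input m ->
  rmem m 4 0 - rmem m 3 0 <= eps * 2%:R ^+ k ->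
  (forall t m', (t <= k * (n * (b + 4) + 7) + 2)%N ->
     assort_returns p v v0 C eps (state_of m) (output_set n m') -> Q t m') ->
  wp assort_loop Q m.
Proof.
move=> Cn Cb I0 gapk post; rewrite /assort_loop.
pose Inv j m' := [/\ has_input m',
  rmem m' 4 0 - rmem m' 3 0 <= eps * 2%:R ^+ j &
  forall S, assort_returns p v v0 C eps (state_of m') S ->
            assort_returns p v v0 C eps (state_of m) S].
apply: (wp_while (B := (n * (b + 4) + 5)%N) (Inv := Inv) (k := k)) => //.
- move=> j m' [I0' gapj ret] /=.
  rewrite (I0'.2 2%N) //= -ltNge => gap.
  case: j gapj => [|j] gapj; first by move: gapj; rewrite expr0 mulr1 leNgt gap.
  split=> //; apply: (wp_assort_body Cn Cb I0' gap) => t m2 tB I2 step.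
  split=> //; split=> //= [|S retS]; last by apply: ret; exact: ReturnsNext step retS.
  have /= -> := assort_step_halves step.
  by rewrite ler_pdivrMr // -mulrA -exprSr.
- move=> j t m' [I0' _ ret] /=.
  rewrite (I0'.2 2%N) //= negbK => gap tB; apply: post; first lia.
  by apply: ret; apply: ReturnsStop.
Qed.

End Algorithm.

Opaque assort_loop.

(** * Initialization and the final count of operations *)

Theorem mainTheorem1 :
  exists (impl : cmd) (c : nat),
  forall (R : realType) (n : nat) (n_gt0 : (0 < n)%N) (p v : 'I_n -> R)
         (v0 : R) (C : nat) (eps : R),
    (forall i j : 'I_n, (i <= j)%N -> p j <= p i) ->
    (forall i : 'I_n, 0 <= p i) ->
    0 < p (Ordinal n_gt0) ->
    0 < v0 ->
    (forall i : 'I_n, 0 <= v i <= 1) ->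
    (1 <= C <= n)%N ->
    0 < eps < p (Ordinal n_gt0) ->
    assort_always p v v0 C eps
      (fun S => feasible C S /\
                max_revenue p v v0 C - eps <= revenue p v v0 S)
      (assort_init n_gt0 p)
    /\
    exists (t : nat) (m : memory R),
      [/\ exec impl (input_memory p v v0 C eps) t m,
          assort_returns p v v0 C eps (assort_init n_gt0 p) (output_set n m)
        & t%:R <= c%:R * (n%:R * log2 C%:R * log2 (p (Ordinal n_gt0) / eps))].
Proof.
(* 28 = 2 * 13 + 2: twice [log2 (p_1 / eps)] passes of cost at most [13 * n * log2 C] each, and 2
   for the last loop test. *)
exists assort_mnl, 28%N => R n n_gt0 p v v0 C eps p_mono p_ge0 p1_gt0 v0_gt0 v01.
move=> /andP[C1 Cn] /andP[eps_gt0 eps_lt].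
have v_ge0 i : 0 <= v i by case/andP: (v01 i).
have [k [k_gt k_le]] : exists k : nat,
    p (Ordinal n_gt0) / eps < 2%:R ^+ k /\
    k%:R <= 2%:R * log2 (p (Ordinal n_gt0) / eps).
  by apply: exists_pow2_gt; rewrite ler_pdivlMr // mul1r ltW.
have [b [b_gt b_le]] : exists b : nat,
    C%:R < 2%:R ^+ b :> R /\ b%:R <= 2%:R * log2 (C%:R : R).
  by apply: exists_pow2_gt; rewrite ler1n.
have Cb : (C < 2 ^ b)%N by move: b_gt; rewrite -natrX ltr_nat.
have gapk : p (Ordinal n_gt0) - 0 <= eps * 2%:R ^+ k.
  by rewrite subr0 mulrC -ler_pdivrMr // ltW.
split.
  apply: (assort_inv_always v0_gt0 v_ge0 (k := k)) => //; split=> /=.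
  - by rewrite /feasible cards1.
  - by apply: divr_ge0; rewrite ?(ltW (denominator_gt0 _ _ _)) //
      sumr_ge0 // => i _; rewrite mulr_ge0.
  (* Every price is at most the first, and the term of [v0] in the denominator only helps, so the
     first price bounds every revenue. *)
  - move=> S _; rewrite /revenue ler_pdivrMr ?denominator_gt0 //.
    rewrite mulrDr; apply: ler_wpDl; first by rewrite mulr_ge0 ?ltW.
    by rewrite mulr_sumr; apply: ler_sum => i _; rewrite ler_wpM2r // p_mono.
have [t [m [run [ret tB]]]] : exists t m,
    exec assort_mnl (input_memory p v v0 C eps) t m /\
    (assort_returns p v v0 C eps (assort_init n_gt0 p) (output_set n m) /\
     (t <= k * (n * (b + 4) + 7) + 2)%N).
  apply: (wp_exec (Q := fun t m => _ /\ _)).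
  rewrite /assort_mnl /=.
  have p1E : array_of p 0 = p (Ordinal n_gt0).
    by rewrite -[0%N]/(val (Ordinal n_gt0)) /array_of valK.
  set m1 := Memory _ _.
  (* The lower bound 0 is the default content of array 3; the two initial assignments supply the
     upper bound and the set of the first item. *)
  have stE : state_of n m1 = assort_init n_gt0 p.
    rewrite /state_of /assort_init /m1 /update /= p1E; congr BsState.
    by apply/setP => -[[|i] lt_i]; rewrite !inE.
  apply: (wp_assort_loop (k := k) v0_gt0 v_ge0 Cn Cb) => //=.
  - by split=> // -[|[|[|]]].
  - by rewrite /update /= p1E.
  - by move=> t m' tB ret; rewrite -stE.
exists t, m; split=> //.
set N : R := n%:R; set l := log2 C%:R in b_le *; set w := log2 _ in k_le *.
have N1 : 1 <= N by rewrite ler1n.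
have l1 : 1 <= l by rewrite le_max lexx.
have w1 : 1 <= w by rewrite le_max lexx.
have NL1 : 1 <= N * l by rewrite mulr_ege1.
have : t%:R <= k%:R * (N * (b%:R + 4%:R) + 7%:R) + 2%:R :> R.
  by rewrite -!(natrD, natrM) ler_nat.
move=> /le_trans; apply.
(* 13 = 2 + 4 + 7, from [b <= 2 * l], [1 <= l] and [1 <= N * l]. *)
have body : N * (b%:R + 4%:R) + 7%:R <= 13%:R * (N * l).
  have := ler_wpM2l (le_trans ler01 N1) b_le.
  have := ler_wpM2l (le_trans ler01 N1) l1.
  by lra.
have body0 : 0 <= N * (b%:R + 4%:R) + 7%:R.
  by rewrite addr_ge0 ?mulr_ge0 ?addr_ge0 // ltW // (lt_le_trans ltr01).
have : k%:R * (N * (b%:R + 4%:R) + 7%:R) <= (2%:R * w) * (13%:R * (N * l)).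
  by apply: ler_pM.
have : 1 <= N * l * w by rewrite mulr_ege1.
by lra.
Qed.
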